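(* Let $\mathscr{A}$ be an abelian category and let $\mathscr{C}$ be an additive subcategory of $\mathscr{A}$ closed under extensions. Then for any $n\geq 1$ and any additive subcategory $\mathscr{X}$ of $\mathscr{C}$: (1) If $\mathscr{X}$ is a cogenerator for $\mathscr{C}$, then $\Omega^n_{\mathscr{C}}(\mathscr{A})=\Omega^n_{\mathscr{X}}(\mathscr{A})$. (2) If $\mathscr{X}$ is a generator for $\mathscr{C}$, then $\Omega^{-n}_{\mathscr{C}}(\mathscr{A})=\Omega^{-n}_{\mathscr{X}}(\mathscr{A})$.
   Context: All subcategories are full, closed under isomorphisms, and additive, i.e. closed under finite direct sums. For a subcategory $\mathscr{D}$ and $n\geq 1$: if there is an exact sequence $0\to A\to D_{n-1}\to D_{n-2}\to\cdots\to D_0\to M\to 0$ in $\mathscr{A}$ with all $D_i$ in $\mathscr{D}$, then $A$ is called an $n$-$\mathscr{D}$-syzygy object and $M$ is called an $n$-$\mathscr{D}$-cosyzygy object. $\Omega^n_{\mathscr{D}}(\mathscr{A})$ (resp. $\Omega^{-n}_{\mathscr{D}}(\mathscr{A})$) denotes the subcategory of all $n$-$\mathscr{D}$-syzygy (resp. $n$-$\mathscr{D}$-cosyzygy) objects. A subcategory $\mathscr{X}$ of $\mathscr{C}$ is a generator (resp. cogenerator) for $\mathscr{C}$ if for every object $C$ in $\mathscr{C}$ there is an exact sequence $0\to C'\to X\to C\to 0$ (resp. $0\to C\to X\to C'\to 0$) with $X$ in $\mathscr{X}$ and $C'$ in $\mathscr{C}$. *)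

(* Defs.v *)
From HB Require Import structures.
From mathcomp Require Import all_boot all_algebra.
From mathcomp Require Import boolp classical_sets.

Set Implicit Arguments.
Unset Strict Implicit.
Unset Printing Implicit Defensive.

Import GRing.Theory.
Local Open Scope classical_set_scope.
Local Open Scope ring_scope.

(* Hom-sets are abelian groups compared by Leibniz equality. The choiceType
   structure carried by a zmodType is no restriction: classically every type
   has one. *)
Record preadditiveCategory := PreadditiveCategory {
  obj :> Type;
  hom : obj -> obj -> zmodType;
  idm : forall X, hom X X;
  comp : forall X Y Z, hom Y Z -> hom X Y -> hom X Z;
  compA : forall W X Y Z (h : hom Y Z) (g : hom X Y) (f : hom W X),
    comp h (comp g f) = comp (comp h g) f;
  comp1m : forall X Y (f : hom X Y), comp (idm Y) f = f;
  compm1 : forall X Y (f : hom X Y), comp f (idm X) = f;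
  compDl : forall X Y Z (g1 g2 : hom Y Z) (f : hom X Y),
    comp (g1 + g2) f = comp g1 f + comp g2 f;
  compDr : forall X Y Z (g : hom Y Z) (f1 f2 : hom X Y),
    comp g (f1 + f2) = comp g f1 + comp g f2
}.

Arguments hom {p} X Y.
Arguments idm {p} X.
Arguments comp {p X Y Z} g f.

Notation "g ∘ f" := (comp g f) (at level 40, left associativity).

Section Notions.
Variable A : preadditiveCategory.

Definition is_zero (Z : A) : Prop :=
  forall X : A, (forall f g : hom X Z, f = g) /\ (forall f g : hom Z X, f = g).

Definition isomorphic (X Y : A) : Prop :=
  exists (f : hom X Y) (g : hom Y X), g ∘ f = idm X /\ f ∘ g = idm Y.

Definition mono (X Y : A) (f : hom X Y) : Prop :=
  forall (W : A) (u v : hom W X), f ∘ u = f ∘ v -> u = v.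

Definition epi (X Y : A) (f : hom X Y) : Prop :=
  forall (W : A) (u v : hom Y W), u ∘ f = v ∘ f -> u = v.

Definition is_kernel (K X Y : A) (k : hom K X) (f : hom X Y) : Prop :=
  f ∘ k = 0 /\
  forall (W : A) (h : hom W X), f ∘ h = 0 -> exists! u : hom W K, k ∘ u = h.

Definition is_cokernel (X Y Q : A) (q : hom Y Q) (f : hom X Y) : Prop :=
  q ∘ f = 0 /\
  forall (W : A) (h : hom Y W), h ∘ f = 0 -> exists! u : hom Q W, u ∘ q = h.

(* For n = 0 this says that S is a zero object. *)
Definition is_direct_sum (n : nat) (F : 'I_n -> A) (S : A) : Prop :=
  exists (inj : forall i, hom (F i) S) (proj : forall i, hom S (F i)),
    [/\ forall i, proj i ∘ inj i = idm (F i),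
        forall i j, i != j -> proj j ∘ inj i = 0
      & \sum_(i < n) inj i ∘ proj i = idm S].

(* im f = Ker (Coker f) *)
Definition is_image (X Y I : A) (i : hom I Y) (f : hom X Y) : Prop :=
  exists (Q : A) (q : hom Y Q), is_cokernel q f /\ is_kernel i q.

(* Im f = Ker g as subobjects of Y *)
Definition exact (X Y Z : A) (f : hom X Y) (g : hom Y Z) : Prop :=
  exists (I : A) (i : hom I Y), is_image i f /\ is_kernel i g.

Definition short_exact (X Y Z : A) (f : hom X Y) (g : hom Y Z) : Prop :=
  exists Z0 Z1 : A,
    [/\ is_zero Z0, is_zero Z1, exact (0 : hom Z0 X) f, exact f g
      & exact g (0 : hom Z Z1)].

(* The exact sequence 0 -> L -> D_(n-1) -> ... -> D_0 -> M -> 0 is stored from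
   right to left: E 0 = 0, E 1 = M, E (k + 2) = D_k for k < n, E (n + 2) = L and
   E (n + 3) = 0; the values of E and d past these indices are irrelevant. *)
Definition exact_resolution (D : set A) (n : nat) (L M : A) : Prop :=
  exists (E : nat -> A) (d : forall i, hom (E i.+1) (E i)),
    [/\ is_zero (E 0%N) /\ is_zero (E n.+3),
        E 1%N = M,
        E n.+2 = L,
        forall k, (k < n)%N -> D (E k.+2)
      & forall i, (i < n.+2)%N -> exact (d i.+1) (d i)].

Definition syzygy (n : nat) (D : set A) : set A :=
  [set L | exists M : A, exact_resolution D n L M].

Definition cosyzygy (n : nat) (D : set A) : set A :=
  [set M | exists L : A, exact_resolution D n L M].

(* Full subcategories are given by their sets of objects. *)
Definition additive_subcategory (D : set A) : Prop :=
  (forall X Y : A, isomorphic X Y -> D X -> D Y) /\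
  (forall (n : nat) (F : 'I_n -> A) (S : A),
     (forall i, D (F i)) -> is_direct_sum F S -> D S).

Definition closed_under_extensions (D : set A) : Prop :=
  forall (X Y Z : A) (f : hom X Y) (g : hom Y Z),
    short_exact f g -> D X -> D Z -> D Y.

Definition generator (X C : set A) : Prop :=
  forall c : A, C c ->
    exists (c' x : A) (f : hom c' x) (g : hom x c),
      [/\ short_exact f g, X x & C c'].

Definition cogenerator (X C : set A) : Prop :=
  forall c : A, C c ->
    exists (x c' : A) (f : hom c x) (g : hom x c'),
      [/\ short_exact f g, X x & C c'].

End Notions.

Record abelianCategory := AbelianCategory {
  abelian_base :> preadditiveCategory;
  has_direct_sums : forall (n : nat) (F : 'I_n -> abelian_base),
    exists S, is_direct_sum F S;
  has_kernels : forall (X Y : abelian_base) (f : hom X Y),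
    exists (K : abelian_base) (k : hom K X), is_kernel k f;
  has_cokernels : forall (X Y : abelian_base) (f : hom X Y),
    exists (Q : abelian_base) (q : hom Y Q), is_cokernel q f;
  mono_normal : forall (X Y : abelian_base) (f : hom X Y), mono f ->
    exists (Z : abelian_base) (g : hom Y Z), is_kernel f g;
  epi_normal : forall (X Y : abelian_base) (f : hom X Y), epi f ->
    exists (Z : abelian_base) (g : hom Z X), is_cokernel f g
}.

(* Main.v *)
From mathcomp Require Import all_boot all_algebra.
From mathcomp Require Import boolp classical_sets.
Require Import Defs.
Local Open Scope classical_set_scope.

(** Part (1) is part (2) in the opposite category, so only the argument for a
    generator X of C is carried out ([chain_generator]).

    The inclusion of X-cosyzygies in C-cosyzygies is clear from X contained in
    C.  For the converse, let M be an (n+1)-C-cosyzygy and cut its resolution at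
    the right end into 0 -> K -> C0 -> M -> 0, where K is an n-C-cosyzygy.
    Choose 0 -> C' -> x -> C0 -> 0 with x in X and C' in C, and pull it back
    along K -> C0.  The pullback K' fits into the two exact sequences
    0 -> K' -> x -> M -> 0 and 0 -> C' -> K' -> K -> 0.  The first one
    is the right end of the desired X-resolution, provided that K' is an
    n-X-cosyzygy.  By induction it suffices that K' is an n-C-cosyzygy, and this
    is [chain_extension]: if n > 0 and 0 -> K2 -> C1 -> K -> 0 is the right end
    of a resolution of K, the pullback P of C1 and K' over K is an extension of
    C1 by C', hence lies in C, and 0 -> K2 -> P -> K' -> 0 is exact, so that P
    replaces C1 while the rest of the resolution is unchanged.  If n = 0 there is
    nothing to show; this is the only place where the left end L of the
    resolution changes.

    Two things make this argument run.  Exactness in an abelian category is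
    equivalent to a criterion that mentions no image and is visibly self-dual
    ([exactP]).  And long exact sequences are handled through the
    inductive predicate [chain], which splices short exact sequences
    ([exact_resolution_chain]) and is also self-dual ([chain_opposite]). *)

Set Implicit Arguments.
Unset Strict Implicit.
Unset Printing Implicit Defensive.

Import GRing.Theory.
Local Open Scope ring_scope.

(** * Morphisms in preadditive categories *)

Section Preadditive.
Variable A : preadditiveCategory.

Lemma comp0m (X Y Z : A) (f : hom X Y) : (0 : hom Y Z) ∘ f = 0.
Proof. by apply: (addrI (0 ∘ f)); rewrite -compDl !addr0. Qed.

Lemma compm0 (X Y Z : A) (g : hom Y Z) : g ∘ (0 : hom X Y) = 0.
Proof. by apply: (addrI (g ∘ 0)); rewrite -compDr !addr0. Qed.

Lemma compNm (X Y Z : A) (g : hom Y Z) (f : hom X Y) : (- g) ∘ f = - (g ∘ f).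
Proof. by apply: (addrI (g ∘ f)); rewrite -compDl !subrr comp0m. Qed.

Lemma compmN (X Y Z : A) (g : hom Y Z) (f : hom X Y) : g ∘ (- f) = - (g ∘ f).
Proof. by apply: (addrI (g ∘ f)); rewrite -compDr !subrr compm0. Qed.

Lemma monoP (X Y : A) (f : hom X Y) :
  mono f <-> forall (W : A) (u : hom W X), f ∘ u = 0 -> u = 0.
Proof.
split=> [mf W u fu|f0 W u v fuv]; first by apply: mf; rewrite fu compm0.
by apply/subr0_eq/f0; rewrite compDr compmN fuv subrr.
Qed.

Lemma epiP (X Y : A) (f : hom X Y) :
  epi f <-> forall (W : A) (u : hom Y W), u ∘ f = 0 -> u = 0.
Proof.
split=> [ef W u uf|f0 W u v fuv]; first by apply: ef; rewrite uf comp0m.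
by apply/subr0_eq/f0; rewrite compDl compNm fuv subrr.
Qed.

Lemma kernel_mono (K X Y : A) (k : hom K X) (f : hom X Y) :
  is_kernel k f -> mono k.
Proof.
move=> [fk kP]; apply/monoP => W u ku.
have [w [_ uniqw]] := kP W 0 (compm0 _ _).
by rewrite -(uniqw u ku) (uniqw 0) ?compm0.
Qed.

Lemma cokernel_epi (X Y Q : A) (q : hom Y Q) (f : hom X Y) :
  is_cokernel q f -> epi q.
Proof.
move=> [qf qP]; apply/epiP => W u uq.
have [w [_ uniqw]] := qP W 0 (comp0m _ _).
by rewrite -(uniqw u uq) (uniqw 0) ?comp0m.
Qed.

Lemma kernel_lift (K X Y W : A) (k : hom K X) (f : hom X Y) (h : hom W X) :
  is_kernel k f -> f ∘ h = 0 -> exists u, k ∘ u = h.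
Proof. by move=> [_ kP] /kP[u [ku _]]; exists u. Qed.

Lemma cokernel_desc (X Y Q W : A) (q : hom Y Q) (f : hom X Y) (h : hom Y W) :
  is_cokernel q f -> h ∘ f = 0 -> exists u, u ∘ q = h.
Proof. by move=> [_ qP] /qP[u [uq _]]; exists u. Qed.

Lemma kernel_of_mono (K X Y : A) (k : hom K X) (f : hom X Y) :
  mono k -> f ∘ k = 0 ->
  (forall (W : A) (h : hom W X), f ∘ h = 0 -> exists u, k ∘ u = h) ->
  is_kernel k f.
Proof.
move=> mk fk lift; split=> // W h /lift[u ku]; exists u; split=> // v kv.
by apply: mk; rewrite ku kv.
Qed.

Lemma cokernel_of_epi (X Y Q : A) (q : hom Y Q) (f : hom X Y) :
  epi q -> q ∘ f = 0 ->
  (forall (W : A) (h : hom Y W), h ∘ f = 0 -> exists u, u ∘ q = h) ->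
  is_cokernel q f.
Proof.
move=> eq qf desc; split=> // W h /desc[u uq]; exists u; split=> // v vq.
by apply: eq; rewrite uq vq.
Qed.

(** Unlike [short_exact], this form is self-dual by definition and gives the
    universal properties at once; [short_exactP] shows that both agree in an
    abelian category. *)
Definition ses (X Y Z : A) (f : hom X Y) (g : hom Y Z) : Prop :=
  is_kernel f g /\ is_cokernel g f.

Lemma isomorphic_refl (X : A) : isomorphic X X.
Proof. by exists (idm X), (idm X); rewrite comp1m. Qed.

Lemma ses_iso_right (L Y K M : A) (f : hom L Y) (g : hom Y K) (h : hom K M)
    (h' : hom M K) :
  h' ∘ h = idm K -> h ∘ h' = idm M -> ses f g -> ses f (h ∘ g).
Proof.
move=> h'h hh' [kf cg]; have [gf _] := kf.
have hg0 (W : A) (u : hom W Y) : (h ∘ g) ∘ u = 0 -> g ∘ u = 0.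
  by move=> e; rewrite -(comp1m (g ∘ u)) -h'h -compA (compA h) e compm0.
split.
  apply: kernel_of_mono; first exact: kernel_mono kf.
    by rewrite -compA gf compm0.
  by move=> W u /hg0; apply: kernel_lift.
apply: cokernel_of_epi; last first.
- move=> W u uf; have [v vg] := cokernel_desc cg uf.
  by exists (v ∘ h'); rewrite -compA (compA h') h'h comp1m.
- by rewrite -compA gf compm0.
apply/epiP => W u /= uhg; rewrite -(compm1 u) -hh' compA.
suff -> : u ∘ h = 0 by rewrite comp0m.
by move/epiP: (cokernel_epi cg); apply; rewrite -compA.
Qed.

(** In the style of diagram chases: [h] plays a generalized element of the kernel
    of [g], and [q] a functional vanishing on the image of [f]. *)
Definition exact_criterion (X Y Z : A) (f : hom X Y) (g : hom Y Z) : Prop :=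
  g ∘ f = 0 /\
  forall (V W : A) (h : hom V Y) (q : hom Y W),
    g ∘ h = 0 -> q ∘ f = 0 -> q ∘ h = 0.

Lemma criterion0m (Z0 X Y : A) (f : hom X Y) :
  exact_criterion (0 : hom Z0 X) f <-> mono f.
Proof.
split=> [[_ ex]|/monoP mf].
  by apply/monoP => W u fu; rewrite -(comp1m u) (ex _ _ u (idm X)) // compm0.
by split=> [|V W h q /mf-> _]; rewrite compm0.
Qed.

Lemma criterionm0 (Z1 X Y : A) (f : hom X Y) :
  exact_criterion f (0 : hom Y Z1) <-> epi f.
Proof.
split=> [[_ ex]|/epiP ef].
  by apply/epiP => W u uf; rewrite -(compm1 u) (ex _ _ (idm Y) u) // comp0m.
by split=> [|V W h q _ /ef->]; rewrite comp0m.
Qed.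

Lemma criterion_epil (W X Y Z : A) (e : hom W X) (f : hom X Y) (g : hom Y Z) :
  epi e -> exact_criterion f g -> exact_criterion (f ∘ e) g.
Proof.
move=> /epiP ee [gf ex]; split=> [|V U h q gh qfe].
  by rewrite compA gf comp0m.
by apply: ex gh _; apply: ee; rewrite -compA.
Qed.

Lemma criterion_monor (X Y Z W : A) (f : hom X Y) (g : hom Y Z) (m : hom Z W) :
  mono m -> exact_criterion f (m ∘ g) <-> exact_criterion f g.
Proof.
move=> /monoP mm; split=> -[gf ex]; split.
- by apply: mm; rewrite compA.
- by move=> V U h q gh; apply: ex; rewrite -compA gh compm0.
- by rewrite -compA gf compm0.
- by move=> V U h q gh; apply: ex; apply: mm; rewrite compA.
Qed.

Lemma ses_criterion (X Y Z : A) (f : hom X Y) (g : hom Y Z) :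
  ses f g -> exact_criterion f g.
Proof.
move=> [kf [_ _]]; have [gf _] := kf; split=> // V W h q.
by move=> /(kernel_lift kf)[u <-] qf; rewrite compA qf comp0m.
Qed.

Lemma zero_from (Z X : A) (f : hom Z X) : is_zero Z -> f = 0.
Proof. by move=> /(_ X)[_]; apply. Qed.

Lemma zero_to (Z X : A) (f : hom X Z) : is_zero Z -> f = 0.
Proof. by move=> /(_ X)[+ _]; apply. Qed.

(** Exact sequences 0 -> L -> D_(n-1) -> ... -> D_0 -> M -> 0 as splices of [n]
    short exact sequences, cut off one by one at the right end.  Length 0 is an
    isomorphism rather than an equality, since it stands for the exact sequence
    0 -> L -> M -> 0. *)
Inductive chain (D : set A) (L : A) : nat -> A -> Prop :=
  | chain_iso (M : A) : isomorphic L M -> chain D L 0 M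
  | chain_cons (n : nat) (K P M : A) (k : hom K P) (p : hom P M) :
      ses k p -> D P -> chain D L n K -> chain D L n.+1 M.

Lemma chain_refl (D : set A) (L : A) : chain D L 0 L.
Proof. exact/chain_iso/isomorphic_refl. Qed.

(** Chains can also be extended at the left end, although their definition
    prefers the right one. *)
Lemma chain_snoc (D : set A) (n : nat) (L P K M : A) (k : hom L P)
    (p : hom P K) :
  ses k p -> D P -> chain D K n M -> chain D L n.+1 M.
Proof.
move=> kp DP; elim=> {n M} [M [h [h' [h'h hh']]]|n K' P' M k' p' kp' DP' _ IH].
  exact: (chain_cons (ses_iso_right h'h hh' kp) DP (chain_refl D L)).
exact: (chain_cons kp' DP' IH).
Qed.

End Preadditive.

(** * The opposite category *)

Definition opposite_base (A : preadditiveCategory) : preadditiveCategory :=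
  @PreadditiveCategory A (fun X Y : A => hom Y X) (fun X => idm X)
    (fun X Y Z (g : hom Z Y) (f : hom Y X) => f ∘ g)
    (fun W X Y Z h g f => esym (compA f g h))
    (fun X Y f => compm1 f) (fun X Y f => comp1m f)
    (fun X Y Z g1 g2 f => compDr f g1 g2)
    (fun X Y Z g f1 f2 => compDl f1 f2 g).

Lemma direct_sum_opposite (A : preadditiveCategory) (n : nat) (F : 'I_n -> A)
    (S : A) :
  is_direct_sum F S -> @is_direct_sum (opposite_base A) n F S.
Proof.
move=> [inj [proj [pi1 pi0 sum1]]]; exists proj, inj; split=> // i j ij.
by apply: pi0; rewrite eq_sym.
Qed.

Definition opposite (A : abelianCategory) : abelianCategory :=
  @AbelianCategory (opposite_base A)
    (fun n F => let: ex_intro T sumT := has_direct_sums (a := A) F in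
                ex_intro _ T (direct_sum_opposite sumT))
    (fun X Y f => has_cokernels (a := A) f)
    (fun X Y f => has_kernels (a := A) f)
    (fun X Y f => @epi_normal A Y X f)
    (fun X Y f => @mono_normal A Y X f).

Lemma ses_opposite (A : preadditiveCategory) (X Y Z : A) (f : hom X Y)
    (g : hom Y Z) :
  @ses (opposite_base A) Z Y X g f <-> ses f g.
Proof. by split=> -[]. Qed.

Lemma chain_opposite (A : preadditiveCategory) (D : set A) (n : nat) (L M : A) :
  @chain (opposite_base A) D M n L <-> chain D L n M.
Proof.
split; elim=> {n} [K [f [g [gf fg]]]|n K P N k p kp DP _ IH].
- by apply: chain_iso; exists f, g.
- by apply: chain_snoc DP IH; apply/ses_opposite; exact: kp.
- by apply: chain_iso; exists f, g.
- by apply: (@chain_snoc (opposite_base A)) DP IH; apply/ses_opposite; exact: kp.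
Qed.

(** * Exactness in abelian categories *)

Section Abelian.
Variable A : abelianCategory.

Lemma mono_kernel_cokernel (X Y Q : A) (f : hom X Y) (q : hom Y Q) :
  mono f -> is_cokernel q f -> is_kernel f q.
Proof.
move=> mf cq; have [Z [r kr]] := mono_normal mf; have [rf _] := kr.
have [s sq] := cokernel_desc cq rf.
apply: kernel_of_mono => //; first by case: cq.
by move=> W h qh; apply: kernel_lift kr _; rewrite -sq -compA qh compm0.
Qed.

Lemma epi_cokernel_kernel (K X Y : A) (k : hom K X) (f : hom X Y) :
  epi f -> is_kernel k f -> is_cokernel f k.
Proof.
move=> ef kk; have [Z [r cr]] := epi_normal ef; have [fr _] := cr.
have [s ks] := kernel_lift kk fr.
apply: cokernel_of_epi => //; first by case: kk.
by move=> W h hk; apply: cokernel_desc cr _; rewrite -ks compA hk comp0m.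
Qed.

Lemma ses_of_epi (K X Y : A) (k : hom K X) (f : hom X Y) :
  epi f -> is_kernel k f -> ses k f.
Proof. by move=> ef kk; split=> //; exact: epi_cokernel_kernel. Qed.

Lemma mono_epi_iso (X Y : A) (f : hom X Y) : mono f -> epi f -> isomorphic X Y.
Proof.
move=> mf ef; have [Z [r kr]] := mono_normal mf; have [rf _] := kr.
have r0 : r = 0 by move/epiP: ef; apply.
have [g fg] : exists g, f ∘ g = idm Y.
  by apply: kernel_lift kr _; rewrite r0 comp0m.
by exists f, g; split=> //; apply: mf; rewrite compA fg comp1m compm1.
Qed.

(** Exactness at Y says that the kernel of the cokernel of [f] is a kernel of
    [g].  A morphism [h] with [g ∘ h = 0] factors through the former, and every
    [q] with [q ∘ f = 0] factors through the cokernel of [f].  Conversely, the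
    criterion applied to a kernel of [g] and a cokernel of [f] makes each of them
    factor as needed. *)
Lemma exactP (X Y Z : A) (f : hom X Y) (g : hom Y Z) :
  exact f g <-> exact_criterion f g.
Proof.
split=> [[I [i [[Q [q [cq kq]]] kg]]]|[gf ex]].
  have [gi _] := kg; have [qi _] := kq; have [qf _] := cq.
  split=> [|V W h r].
    by have [u <-] := kernel_lift kq qf; rewrite compA gi comp0m.
  move=> /(kernel_lift kg)[u <-] /(cokernel_desc cq)[v <-].
  by rewrite -compA (compA q) qi comp0m compm0.
have [I [i ki]] := has_kernels g; have [Q [q cq]] := has_cokernels f.
have [gi _] := ki; have [qf _] := cq.
exists I, i; split=> //; exists Q, q; split=> //.
have [v vq] := cokernel_desc cq gf.
apply: kernel_of_mono; first exact: kernel_mono ki.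
  exact: ex gi qf.
by move=> W h qh; apply: kernel_lift ki _; rewrite -vq -compA qh compm0.
Qed.

Lemma criterion_ses (X Y Z : A) (f : hom X Y) (g : hom Y Z) :
  mono f -> epi g -> exact_criterion f g -> ses f g.
Proof.
move=> mf eg [gf ex]; apply: ses_of_epi => //; apply: kernel_of_mono => //.
move=> W h gh; have [Q [q kf]] := mono_normal mf; have [qf _] := kf.
by apply: kernel_lift kf _; apply: ex.
Qed.

Lemma zero_exists : exists Z : A, is_zero Z.
Proof.
have /= [Z [i [p [_ _]]]] := has_direct_sums
  (fun i : 'I_0 => match notF (ltn_ord i) return A with end).
rewrite big_ord0 => id0; exists Z => X; split=> f g.
  by rewrite -(comp1m f) -(comp1m g) -id0 !comp0m.
by rewrite -(compm1 f) -(compm1 g) -id0 !compm0.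
Qed.

Lemma short_exactP (X Y Z : A) (f : hom X Y) (g : hom Y Z) :
  short_exact f g <-> ses f g.
Proof.
split=> [[Z0 [Z1 [_ _]]]|fg].
  move=> /exactP/criterion0m mf /exactP ex /exactP/criterionm0 eg.
  exact: criterion_ses.
have [O zO] := zero_exists; have [kf cg] := fg.
exists O, O; split=> //; apply/exactP.
- by apply/criterion0m; exact: kernel_mono kf.
- exact: ses_criterion.
- by apply/criterionm0; exact: cokernel_epi cg.
Qed.

(** Exactness says that [d] maps onto the kernel of [g].  If [m] is the image of
    [e], then [k ∘ m] is a subobject of Y through which [d] factors, hence so
    does [k]; thus [m] is split epi and the cokernel of [e] vanishes. *)
Lemma epi_to_kernel (X Y Z K : A) (d : hom X Y) (g : hom Y Z) (k : hom K Y)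
    (e : hom X K) :
  exact_criterion d g -> is_kernel k g -> k ∘ e = d -> epi e.
Proof.
move=> [_ ex] kk ked; have [Q [q cq]] := has_cokernels e.
have [I [m km]] := has_kernels q; have [qe _] := cq; have [qm _] := km.
have [s ms] := kernel_lift km qe; have mk := kernel_mono kk.
have mkm : mono (k ∘ m).
  by move=> W u v; rewrite -!compA => /mk; exact: (kernel_mono km).
have [R [r kr]] := mono_normal mkm; have [rkm _] := kr.
have rk : r ∘ k = 0.
  apply: ex; first by case: kk.
  by rewrite -ked -ms (compA k) compA rkm comp0m.
have [t kmt] := kernel_lift kr rk.
have mt : m ∘ t = idm K by apply: mk; rewrite compA kmt compm1.
have q0 : q = 0 by rewrite -(compm1 q) -mt compA qm comp0m.
apply/epiP => W u ue; have [v <-] := cokernel_desc cq ue.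
by rewrite q0 compm0.
Qed.

(** * Pullbacks *)

Lemma biproduct (X Y : A) : exists (S : A) (i1 : hom X S) (i2 : hom Y S)
    (p1 : hom S X) (p2 : hom S Y),
  [/\ p1 ∘ i1 = idm X, p2 ∘ i2 = idm Y, p1 ∘ i2 = 0, p2 ∘ i1 = 0
    & i1 ∘ p1 + i2 ∘ p2 = idm S].
Proof.
pose F (i : 'I_2) : A := if nat_of_ord i is 0%N then X else Y.
have [S [inj [proj [pi1 pi0 sum1]]]] := has_direct_sums F.
pose a : 'I_2 := @Ordinal 2 0 isT; pose b : 'I_2 := @Ordinal 2 1 isT.
exists S, (inj a), (inj b), (proj a), (proj b); split.
- exact: (pi1 a).
- exact: (pi1 b).
- exact: (pi0 b a).
- exact: (pi0 a b).
rewrite -sum1 (bigD1 a) //= (bigD1 b) //= big1 ?addr0 //.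
by move=> [[|[|i]] lt].
Qed.

(** Epimorphisms are stable under pullback: the pullback is the kernel of
    [phi = f p1 - g p2] on the biproduct S, and [phi] is epi since [g] is, hence
    a cokernel of the pullback.  If [u] kills the pullback of [g], then [u p1]
    on S factors as [t phi]; restricting to Y gives [t g = 0], so [t] and [u]
    vanish. *)
Lemma pullback_epi (X Y Z : A) (f : hom X Z) (g : hom Y Z) :
  epi g ->
  exists (P : A) (p1 : hom P X) (p2 : hom P Y),
    [/\ f ∘ p1 = g ∘ p2, epi p1,
        forall (W : A) (u : hom W X) (v : hom W Y), f ∘ u = g ∘ v ->
          exists w, p1 ∘ w = u /\ p2 ∘ w = v
      & forall (W : A) (w : hom W P), p1 ∘ w = 0 -> p2 ∘ w = 0 -> w = 0].
Proof.
move=> eg; have [S [i1 [i2 [p1 [p2 [p1i1 p2i2 p1i2 p2i1 sum1]]]]]] := biproduct X Y.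
pose phi := f ∘ p1 - g ∘ p2.
have phiE (W : A) (u : hom W S) :
    phi ∘ u = f ∘ (p1 ∘ u) - g ∘ (p2 ∘ u).
  by rewrite compDl compNm !compA.
have phii2 : phi ∘ i2 = - g by rewrite phiE p1i2 p2i2 compm0 compm1 sub0r.
have ephi : epi phi.
  apply/epiP => W u uphi; move/epiP: eg; apply.
  by apply: oppr_inj; rewrite -compmN -phii2 compA uphi comp0m oppr0.
have [P [k kk]] := has_kernels phi; have [phik _] := kk.
have ck := epi_cokernel_kernel ephi kk.
exists P, (p1 ∘ k), (p2 ∘ k); split.
- by apply/subr0_eq; rewrite -phiE.
- apply/epiP => W u; rewrite compA => /(cokernel_desc ck)[t tphi].
  have t0 : t = 0.
    move/epiP: eg; apply; apply: oppr_inj.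
    by rewrite -compmN -phii2 compA tphi -compA p1i2 compm0 oppr0.
  by rewrite -(compm1 u) -p1i1 compA -tphi t0 !comp0m.
- move=> W u v fugv.
  have p1w : p1 ∘ (i1 ∘ u + i2 ∘ v) = u.
    by rewrite compDr !compA p1i1 p1i2 comp1m comp0m addr0.
  have p2w : p2 ∘ (i1 ∘ u + i2 ∘ v) = v.
    by rewrite compDr !compA p2i1 p2i2 comp1m comp0m add0r.
  have [w kw] : exists w, k ∘ w = i1 ∘ u + i2 ∘ v.
    by apply: kernel_lift kk _; rewrite phiE p1w p2w fugv subrr.
  by exists w; rewrite -!compA kw.
- move=> W w; rewrite -!compA => p1kw p2kw.
  move/monoP: (kernel_mono kk); apply.
  by rewrite -(comp1m (k ∘ w)) -sum1 compDl -!compA p1kw p2kw !compm0 addr0.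
Qed.

(** Opposite sides of a pullback square have the same kernel.  The last two
    clauses are the two ways in which this pullback is used: along the inclusion
    of a kernel, to enlarge that kernel, and along an epimorphism, to obtain an
    object that is an extension in two ways. *)
Lemma pullback_ses (N X Y Z : A) (f : hom X Z) (a : hom N Y) (g : hom Y Z) :
  ses a g ->
  exists (P : A) (p1 : hom P X) (p2 : hom P Y) (a' : hom N P),
    [/\ ses a' p1,
        forall (M : A) (h : hom Z M), is_kernel f h -> is_kernel p2 (h ∘ g)
      & forall (N' : A) (b : hom N' X), ses b f ->
          exists b' : hom N' P, ses b' p2].
Proof.
move=> [ka ca]; have eg := cokernel_epi ca; have [ga _] := ka.
have [P [p1 [p2 [sq ep1 lift mono2]]]] := pullback_epi f eg.
have [a' [p1a' p2a']] : exists w, p1 ∘ w = 0 /\ p2 ∘ w = a.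
  by apply: lift; rewrite compm0 ga.
exists P, p1, p2, a'; split.
- apply: ses_of_epi => //; apply: kernel_of_mono => //.
    apply/monoP => W u a'u; move/monoP: (kernel_mono ka); apply.
    by rewrite -p2a' -compA a'u compm0.
  move=> W h p1h; have [u au] : exists u, a ∘ u = p2 ∘ h.
    by apply: kernel_lift ka _; rewrite compA -sq -compA p1h compm0.
  exists u; apply/subr0_eq/mono2; rewrite compDr compmN compA.
    by rewrite p1a' comp0m p1h subrr.
  by rewrite p2a' au subrr.
- move=> M h kf; have [hf _] := kf; apply: kernel_of_mono.
  + apply/monoP => W w p2w; apply: mono2 => //.
    move/monoP: (kernel_mono kf); apply.
    by rewrite compA sq -compA p2w compm0.
  + by rewrite -compA -sq compA hf comp0m.
  + move=> W v; rewrite -compA => /(kernel_lift kf)[u fu].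
    by have [w [_ p2w]] := lift _ _ _ fu; exists w.
- move=> N' b [kb cf]; have ef := cokernel_epi cf; have [fb _] := kb.
  have [b' [p1b' p2b']] : exists w, p1 ∘ w = b /\ p2 ∘ w = 0.
    by apply: lift; rewrite compm0 fb.
  have ep2 : epi p2.
    (* Any other pullback of f and g maps to P over Y; the one that starts from
       the epimorphism f has an epimorphism to Y. *)
    have [P' [q2 [q1 [sq' eq2 _ _]]]] := pullback_epi g ef.
    have [w [_ p2w]] := lift _ _ _ (esym sq').
    apply/epiP => W u up2; move/epiP: eq2; apply.
    by rewrite -p2w compA up2 comp0m.
  exists b'; apply: ses_of_epi => //; apply: kernel_of_mono => //.
    apply/monoP => W u b'u; move/monoP: (kernel_mono kb); apply.
    by rewrite -p1b' -compA b'u compm0.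
  move=> W h p2h; have [u bu] : exists u, b ∘ u = p1 ∘ h.
    by apply: kernel_lift kb _; rewrite compA sq -compA p2h compm0.
  exists u; apply/subr0_eq/mono2; rewrite compDr compmN compA.
    by rewrite p1b' bu subrr.
  by rewrite p2b' comp0m p2h subrr.
Qed.

(** * Resolutions as chains of short exact sequences *)

Lemma exact_resolution0 (D : set A) (L M : A) :
  exact_resolution D 0 L M <-> isomorphic L M.
Proof.
split=> [[E [d [[z0 z3] <- <- _ ex]]]|[f [g [gf fg]]]].
  have := ex 1%N isT; rewrite (zero_from (d 2%N) z3) => /exactP/criterion0m mf.
  have := ex 0%N isT; rewrite (zero_to (d 0%N) z0) => /exactP/criterionm0 ef.
  exact: mono_epi_iso mf ef.
have [O zO] := zero_exists.
pose E i : A := match i with 1%N => M | 2%N => L | _ => O end.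
pose d i : hom (E i.+1) (E i) :=
  match i return hom (E i.+1) (E i) with 1%N => f | _ => 0 end.
exists E, d; split=> // -[|[|//]] _; apply/exactP.
  by apply/criterionm0 => W u v ufv; rewrite -(compm1 u) -(compm1 v) -fg !compA ufv.
by apply/criterion0m => W u v ufv; rewrite -(comp1m u) -(comp1m v) -gf -!compA ufv.
Qed.

(** The morphism D_1 -> D_0 of the longer sequence and the morphism D_1 -> K onto
    the kernel of D_0 -> M determine each other. *)
Lemma exact_resolutionS (D : set A) (n : nat) (L M : A) :
  exact_resolution D n.+1 L M <->
  exists (K P : A) (k : hom K P) (p : hom P M),
    [/\ ses k p, D P & exact_resolution D n L K].
Proof.
split=> [[E [d [[z0 zn] <- <- DE /(_ _ _)/exactP ex]]]|].
  have ep : epi (d 1%N).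
    by have := ex 0%N isT; rewrite (zero_to (d 0%N) z0) => /criterionm0.
  have [K [k kk]] := has_kernels (d 1%N).
  have ex1 := ex 1%N isT; have [dd _] := ex1.
  have [e ke] := kernel_lift kk dd.
  exists K, (E 2%N), k, (d 1%N); split; first exact: ses_of_epi.
    exact: (DE 0%N).
  pose E' i : A :=
    match i with 0%N => E 0%N | 1%N => K | j.+2 => E j.+3 end.
  pose d' i : hom (E' i.+1) (E' i) :=
    match i return hom (E' i.+1) (E' i) with
    | 0%N => 0 | 1%N => e | j.+2 => d j.+3 end.
  exists E', d'; split=> //; first by move=> j lt_jn; exact: (DE j.+1).
  move=> [|[|i]] lt_in; apply/exactP.
  - exact/criterionm0/(epi_to_kernel ex1 kk ke).
  - by apply/(criterion_monor _ _ (kernel_mono kk)); rewrite ke; exact: (ex 2%N).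
  - exact: (ex i.+3).
move=> [K [P [k [p [kp DP [E [d [[z0 zn] E1 E2 DE /(_ _ _)/exactP ex]]]]]]]].
subst K L; have [kk cp] := kp.
have ee : epi (d 1%N).
  by have := ex 0%N isT; rewrite (zero_to (d 0%N) z0) => /criterionm0.
pose E' i : A :=
  match i with 0%N => E 0%N | 1%N => M | 2%N => P | j.+3 => E j.+2 end.
pose d' i : hom (E' i.+1) (E' i) :=
  match i return hom (E' i.+1) (E' i) with
  | 0%N => 0 | 1%N => p | 2%N => k ∘ d 1%N | j.+3 => d j.+2 end.
exists E', d'; split=> //; first by move=> [|j] lt_jn //; exact: DE.
move=> [|[|[|i]]] lt_in; apply/exactP.
- exact/criterionm0/(cokernel_epi cp).
- exact/criterion_epil/ses_criterion.
- by apply/(criterion_monor _ _ (kernel_mono kk)); exact: (ex 1%N).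
- exact: (ex i.+2).
Qed.

Lemma exact_resolution_chain (D : set A) (n : nat) (L M : A) :
  exact_resolution D n L M <-> chain D L n M.
Proof.
elim: n M => [|n IH] M; split.
- by move=> /exact_resolution0; exact: chain_iso.
- by move=> c; inversion c; exact/exact_resolution0.
- move=> /exact_resolutionS[K [P [k [p [kp DP /IH]]]]].
  exact: chain_cons kp DP.
- move=> c; inversion c as [|m K P N k p kp DP cK]; subst.
  by apply/exact_resolutionS; exists K, P, k, p; split=> //; exact/IH.
Qed.

Lemma exact_resolution_mono (D D' : set A) (n : nat) (L M : A) :
  D `<=` D' -> exact_resolution D n L M -> exact_resolution D' n L M.
Proof.
move=> DD' [E [d [z E1 E2 DE ex]]]; exists E, d; split=> // k /DE.
exact: DD'.
Qed.

(** * Changing the resolving subcategory *)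

(** For [n > 0] the last term of the resolution is replaced by its pullback along
    [q], an extension of it by [N]. *)
Lemma chain_extension (C : set A) (n : nat) (L N K' K : A) (a : hom N K')
    (q : hom K' K) :
  closed_under_extensions C -> ses a q -> C N -> chain C L n K ->
  exists L', chain C L' n K'.
Proof.
move=> Cext aq CN cK; inversion cK as [|m K2 P M k p kp CP cK2]; subst.
  by exists K'; exact: chain_refl.
have [R [p1 [p2 [a' [ses1 _ /(_ _ _ kp)[b' ses2]]]]]] := pullback_ses p aq.
exists L; apply: chain_cons ses2 _ cK2.
by apply: Cext CN CP; apply/short_exactP; exact: ses1.
Qed.

(** The induction is on [n] with M and L arbitrary: the kernel of the new right
    end differs from the old one by an extension. *)
Lemma chain_generator (C X : set A) (n : nat) (L M : A) :
  closed_under_extensions C -> generator X C -> chain C L n M ->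
  exists L', chain X L' n M.
Proof.
move=> Cext gen; elim: n L M => [|n IH] L M cM.
  by exists M; exact: chain_refl.
inversion cM as [|m K P N k p kp CP cK]; subst.
have [N' [x [a [b [/short_exactP ab Xx CN']]]]] := gen _ CP.
have [K' [p1 [p2 [a' [ses1 ker2 _]]]]] := pullback_ses k ab.
have [L1 cK'] := chain_extension Cext ses1 CN' cK.
have [L' xK'] := IH _ _ cK'.
have [kk cp] := kp; have [_ cb] := ab.
exists L'; apply: (chain_cons (k := p2) (p := p ∘ b)) Xx xK'.
apply: ses_of_epi; last exact: ker2.
move=> W u v; rewrite !compA => /(cokernel_epi cb).
exact: (cokernel_epi cp).
Qed.

Lemma cosyzygy_generator (C X : set A) (n : nat) :
  closed_under_extensions C -> generator X C ->
  cosyzygy n C `<=` cosyzygy n X.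
Proof.
move=> Cext gen M [L /exact_resolution_chain/(chain_generator Cext gen)].
by move=> [L' /exact_resolution_chain res]; exists L'.
Qed.

End Abelian.

(** * Duality *)

Lemma short_exact_opposite (A : abelianCategory) (X Y Z : A) (f : hom X Y)
    (g : hom Y Z) :
  @short_exact (opposite A) Z Y X g f <-> short_exact f g.
Proof.
by split=> /short_exactP/ses_opposite fg; apply/short_exactP.
Qed.

Lemma closed_under_extensions_opposite (A : abelianCategory) (C : set A) :
  closed_under_extensions C -> @closed_under_extensions (opposite A) C.
Proof.
move=> Cext X Y Z f g /short_exact_opposite ex CX CZ.
exact: Cext ex CZ CX.
Qed.

Lemma cogenerator_opposite (A : abelianCategory) (X C : set A) :
  cogenerator X C -> @generator (opposite A) X C.
Proof.
move=> cog c /cog[x [c' [f [g [ex Xx Cc']]]]].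
by exists c', x, g, f; split=> //; exact/short_exact_opposite.
Qed.

Lemma syzygy_opposite (A : abelianCategory) (D : set A) (n : nat) (L : A) :
  @cosyzygy (opposite A) n D L <-> syzygy n D L.
Proof.
split=> -[M /exact_resolution_chain/chain_opposite c]; exists M.
  exact/exact_resolution_chain.
exact/exact_resolution_chain.
Qed.

Lemma syzygy_cogenerator (A : abelianCategory) (C X : set A) (n : nat) :
  closed_under_extensions C -> cogenerator X C -> syzygy n C `<=` syzygy n X.
Proof.
move=> /closed_under_extensions_opposite Cext /cogenerator_opposite gen L.
by move=> /syzygy_opposite/(cosyzygy_generator Cext gen)/syzygy_opposite.
Qed.

Theorem corollary5p4 (A : abelianCategory) (C : set A)
    (C_additive : additive_subcategory C)
    (C_ext : closed_under_extensions C)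
    (n : nat) (n_ge1 : (1 <= n)%N)
    (X : set A) (X_additive : additive_subcategory X) (X_sub_C : X `<=` C) :
  (cogenerator X C -> syzygy n C = syzygy n X) /\
  (generator X C -> cosyzygy n C = cosyzygy n X).
Proof.
split=> gen; apply/seteqP; split.
- exact: syzygy_cogenerator.
- by move=> L [M res]; exists M; exact: exact_resolution_mono res.
- exact: cosyzygy_generator.
- by move=> M [L res]; exists L; exact: exact_resolution_mono res.
Qed.
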